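(* Let $\mathrm{H}\in C^1(\mathbb{R}^{n\times n}_s)$, let $\Omega\subseteq\mathbb{R}^n$ be an open set and let $u\in C^3(\Omega)$. Consider the continuous vector field $$\mathscr{V}:=\mathrm{H}_X(\mathrm{D}^2u)\,\mathrm{D}\big(\mathrm{H}(\mathrm{D}^2u)\big):\ \Omega\longrightarrow\mathbb{R}^n$$ (matrix times vector) and, for a point $x\in\Omega$ with $\mathscr{V}(x)\neq0$, the initial value problem $$\dot\gamma(t)=\mathrm{sgn}\big(\mathscr{V}(\gamma(t))\big)\ \ (t\neq 0),\qquad \gamma(0)=x. \qquad (\ast)$$ Then along any such trajectory we have the differential identity $$\big|\mathscr{V}(\gamma(t))\big|\,\frac{d}{dt}\Big(\mathrm{H}\big(\mathrm{D}^2u(\gamma(t))\big)\Big)=\mathrm{A}^2_\infty u(\gamma(t)).$$ Hence $\mathrm{A}^2_\infty u=0$ in $\Omega$ if and only if for every $x\in\Omega$ with $\mathscr{V}(x)\neq0$ there exist $\varepsilon>0$ and a $C^1$ solution $\gamma:(-\varepsilon,\varepsilon)\to\Omega$ of $(\ast)$ such that $\mathrm{H}\big(\mathrm{D}^2u(\gamma(t))\big)=\mathrm{H}\big(\mathrm{D}^2u(x)\big)$ for all $|t|<\varepsilon$.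
   Context: $\mathbb{R}^{n\times n}_s$ is the space of real symmetric $n\times n$ matrices, $\mathrm{H}_X=(\mathrm{H}_{X_{ij}})$ is the gradient of $\mathrm{H}$ (a symmetric matrix) with respect to its matrix argument, taken with respect to the Euclidean inner product $X:Y=\sum_{i,j}X_{ij}Y_{ij}$. $\mathrm{D},\mathrm{D}^2,\mathrm{D}^3$ denote gradient, hessian and third derivative. For a vector $v\neq 0$, $\mathrm{sgn}(v)=v/|v|$, and $\mathrm{sgn}(0)=0$. The operator $\mathrm{A}^2_\infty$ is $$\mathrm{A}^2_\infty u:=\sum_{i,j,k,l,p,q=1}^n \mathrm{H}_{X_{ij}}(\mathrm{D}^2u)\,\mathrm{H}_{X_{kl}}(\mathrm{D}^2u)\,\mathrm{H}_{X_{pq}}(\mathrm{D}^2u)\,\mathrm{D}^3_{ikl}u\,\mathrm{D}^3_{jpq}u,$$ which for $u\in C^3$ equals $\mathrm{H}_X(\mathrm{D}^2u):\mathrm{D}(\mathrm{H}(\mathrm{D}^2u))\otimes\mathrm{D}(\mathrm{H}(\mathrm{D}^2u))$. *)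

(* Defs.v *)
From HB Require Import structures.
From mathcomp Require Import all_boot all_order all_algebra.
From mathcomp Require Import all_classical all_reals all_analysis.

Set Implicit Arguments.
Unset Strict Implicit.
Unset Printing Implicit Defensive.

Import Order.TTheory GRing.Theory Num.Theory.
Import numFieldNormedType.Exports.

Local Open Scope classical_set_scope.
Local Open Scope ring_scope.

(* The library norm on matrices is the sup norm, hence the explicit Euclidean
   structure; for column vectors [frob] is the usual scalar product. *)
Definition frob (R : realType) (m n : nat) (X Y : 'M[R]_(m, n)) : R :=
  \sum_(i < m) \sum_(j < n) X i j * Y i j.

Definition enorm (R : realType) (m n : nat) (X : 'M[R]_(m, n)) : R :=
  Num.sqrt (frob X X).

(* At [v = 0] this is [0], since [_ *: 0 = 0]. *)
Definition sgnv (R : realType) (n : nat) (v : 'cV[R]_n) : 'cV[R]_n :=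
  (enorm v)^-1 *: v.

Definition symm (R : realType) (n : nat) : set 'M[R]_n := [set X | X^T = X].

(* A function on the space of symmetric matrices is encoded by a function on
   all matrices whose values outside [symm] are never used: the Frechet
   derivative below is taken inside the subspace [symm], and it is represented
   by a symmetric matrix through the inner product [frob]. *)
Definition is_sgradient (R : realType) (n : nat) (H : 'M[R]_n -> R)
    (X G : 'M[R]_n) : Prop :=
  symm G /\
  forall e : R, 0 < e -> \forall Y \near within (@symm R n) (nbhs (0 : 'M[R]_n)),
    `|H (X + Y) - H X - frob G Y| <= e * enorm Y.

(* At most one [G] satisfies [is_sgradient H X G], so the choice is irrelevant. *)
Definition sgradient (R : realType) (n : nat) (H : 'M[R]_n -> R) (X : 'M[R]_n) :
    'M[R]_n :=
  get [set G | is_sgradient H X G].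

Definition C1_symm (R : realType) (n : nat) (H : 'M[R]_n -> R) : Prop :=
  (forall X, symm X -> exists G, is_sgradient H X G) /\
  {within @symm R n, continuous (sgradient H)}.

Definition evec (R : realType) (n : nat) (i : 'I_n) : 'cV[R]_n :=
  delta_mx i ord0.

Definition partial (R : realType) (n : nat) (i : 'I_n) (f : 'cV[R]_n -> R) :
    'cV[R]_n -> R :=
  'D_(evec R i) f.

Fixpoint Ck (R : realType) (n k : nat) (Omega : set 'cV[R]_n)
    (f : 'cV[R]_n -> R) : Prop :=
  (forall x, Omega x -> {for x, continuous f}) /\
  if k is k'.+1 then
    forall i : 'I_n, (forall x, Omega x -> derivable f x (evec R i)) /\
      Ck k' Omega (partial i f)
  else True.

Definition gradient (R : realType) (n : nat) (f : 'cV[R]_n -> R)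
    (x : 'cV[R]_n) : 'cV[R]_n :=
  \col_(i < n) partial i f x.

Definition hessian (R : realType) (n : nat) (u : 'cV[R]_n -> R)
    (x : 'cV[R]_n) : 'M[R]_n :=
  \matrix_(i < n, j < n) partial i (partial j u) x.

Definition deriv3 (R : realType) (n : nat) (u : 'cV[R]_n -> R)
    (i j k : 'I_n) (x : 'cV[R]_n) : R :=
  partial i (partial j (partial k u)) x.

Definition A2infty (R : realType) (n : nat) (H : 'M[R]_n -> R)
    (u : 'cV[R]_n -> R) (x : 'cV[R]_n) : R :=
  let HX := sgradient H (hessian u x) in
  \sum_(i < n) \sum_(j < n) \sum_(k < n) \sum_(l < n) \sum_(p < n) \sum_(q < n)
    HX i j * HX k l * HX p q * deriv3 u i k l x * deriv3 u j p q x.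

Definition vfield (R : realType) (n : nat) (H : 'M[R]_n -> R)
    (u : 'cV[R]_n -> R) (x : 'cV[R]_n) : 'cV[R]_n :=
  sgradient H (hessian u x) *m gradient (fun y => H (hessian u y)) x.

(* [g] is a trajectory in [Omega], on the open interval ]a, b[ around [0], of
   g' = sgn (V g) for t <> 0, g 0 = x; no differentiability is assumed at
   [t = 0], where the equation is not imposed. *)
Definition is_trajectory (R : realType) (n : nat) (Omega : set 'cV[R]_n)
    (V : 'cV[R]_n -> 'cV[R]_n) (x : 'cV[R]_n) (a b : R) (g : R -> 'cV[R]_n) :
    Prop :=
  [/\ a < 0 < b,
      forall t, t \in `]a, b[ -> Omega (g t) /\ {for t, continuous g},
      forall t, t \in `]a, b[ -> t != 0 ->
        derivable g t 1 /\ derive1 g t = sgnv (V (g t))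
    & g 0 = x].

Definition C1_curve (R : realType) (n : nat) (a b : R) (g : R -> 'cV[R]_n) :
    Prop :=
  forall t, t \in `]a, b[ -> derivable g t 1 /\ {for t, continuous (derive1 g)}.

(* Main.v *)
(* Write h(x) = H(D^2 u(x)). By the chain rule Dh = H_X : D^3 u, so the
   operator is A^2_oo u = Dh . V, while along a trajectory the derivative of h
   is Dh . sgn V; this is the identity, also at t = 0 because the derivative of
   the trajectory has a limit there. If A^2_oo u = 0, then h is constant on any
   trajectory on which V does not vanish, and one exists by Peano's theorem: as
   |sgn V| <= 1 on the whole space, the Euler scheme is defined for all times
   and only continuity of sgn V near x is needed. *)
Require Import Defs.
From HB Require Import structures.
From mathcomp Require Import all_boot all_order all_algebra.
From mathcomp Require Import all_classical all_reals all_analysis.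
From mathcomp Require Import ring lra.

Set Implicit Arguments.
Unset Strict Implicit.
Unset Printing Implicit Defensive.

Import Order.TTheory GRing.Theory Num.Theory.
Import numFieldNormedType.Exports.

Local Open Scope classical_set_scope.
Local Open Scope ring_scope.

(** * Derivatives along directions and curves *)

(** [H] is differentiable, and its gradient continuous, only inside [symm]; the chain rule therefore
    needs the Hessian to be symmetric at all points near the given one. As [Ck] speaks of iterated
    partial derivatives alone, this symmetry and the total differentiability of C^1 functions are
    both derived from the mean value theorem. The chain rule is proved for arbitrary curves: along
    coordinate lines it yields an explicit formula for Dh, from which V is seen to be continuous. In
    Peano's theorem the derivative of the limit comes from an increment estimate on the Euler points
    that is uniform in the mesh. For the converse implication the identity is read at t = 0:
    constancy of h along the curve makes its left side vanish, and its right side is the operator at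
    x. Where V(x) = 0 the operator vanishes as Dh . V. *)

Lemma mx_entry_le (R : realType) (m n : nat) (X : 'M[R]_(m, n)) i j :
  `|X i j| <= `|X|.
Proof.
rewrite [leRHS]/Num.Def.normr/= mx_normrE.
exact: (le_bigmax _ (fun p : 'I_m * 'I_n => `|X p.1 p.2|) (i, j)).
Qed.

Lemma mx_norm_le (R : realType) (m n : nat) (X : 'M[R]_(m, n)) (e : R) :
  0 <= e -> (forall i j, `|X i j| <= e) -> `|X| <= e.
Proof.
move=> e0 Xe; rewrite [leLHS]/Num.Def.normr/= mx_normrE.
by rewrite (bigmax_le _ e0)// => -[i j] _; exact: Xe.
Qed.

Lemma cvg_mx_entry (R : realType) (T : Type) (F : set_system T) (m n : nat)
    (f : T -> 'M[R]_(m, n)) (l : 'M[R]_(m, n)) :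
  Filter F -> (forall i j, f x i j @[x --> F] --> l i j) -> f @ F --> l.
Proof.
move=> FF fl; apply/cvgrPdist_le => e e0.
have : \forall x \near F, forall p : 'I_m * 'I_n,
    `|l p.1 p.2 - f x p.1 p.2| <= e.
  apply: filter_forall => -[i j] /=.
  exact: ((cvgrPdist_le _ _).1 (fl i j)).
apply: filterS => x lfx; apply: mx_norm_le (ltW e0) _ => i j.
by rewrite !mxE; exact: (lfx (i, j)).
Qed.

(** Multiplying the difference quotient by [h] makes the estimate trivial at [h = 0], so punctured
    neighbourhoods disappear and derivatives can be combined as plain inequalities. *)
Lemma is_deriveP (R : realType) (V W : normedModType R) (f : V -> W) (a v : V)
    (d : W) :
  is_derive a v f d <->
  forall e : R, 0 < e -> \forall h \near (0 : R),
    `|f (a + h *: v) - f a - h *: d| <= e * `|h|.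
Proof.
have quot (h : R) : h != 0 ->
    `|d - h^-1 *: (f (h *: v + a) - f a)| * `|h| =
    `|f (a + h *: v) - f a - h *: d|.
  move=> h0; rewrite mulrC -normrZ scalerBr scalerA mulfV// scale1r distrC.
  by rewrite (addrC a).
split => [fd e e0|fd].
  have : h^-1 *: (f (h *: v + a) - f a) @[h --> 0^'] --> d.
    by case: fd => + <-.
  move=> /cvgrPdist_le/(_ _ e0); rewrite near_withinE; apply: filterS => h fh.
  have [->|h0] := eqVneq h 0.
    by rewrite !scale0r addr0 !subrr !normr0 mulr0.
  by rewrite -quot// ler_wpM2r// fh.
have fl : h^-1 *: (f (h *: v + a) - f a) @[h --> 0^'] --> d.
  apply/cvgrPdist_le => e e0; rewrite near_withinE.
  apply: filterS (fd _ e0) => h fh h0.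
  by rewrite -(ler_pM2r (_ : 0 < `|h|)) ?normr_gt0// quot.
by split; [apply/cvg_ex; exists d|exact: cvg_lim fl].
Qed.

Lemma is_derive1P (R : realType) (W : normedModType R) (f : R -> W) (t : R)
    (d : W) :
  is_derive t 1 f d <->
  forall e : R, 0 < e -> \forall s \near t,
    `|f s - f t - (s - t) *: d| <= e * `|s - t|.
Proof.
rewrite is_deriveP; split => fd e e0.
  rewrite (near_shift 0); apply: filterS (fd _ e0) => h /=.
  by rewrite subr0 addrK [_%:A]mulr1 (addrC t).
rewrite (near_shift t); apply: filterS (fd _ e0) => s /=.
by rewrite sub0r [_%:A]mulr1 (addrC t) subrK.
Qed.

Lemma is_derive_line (R : realType) (V W : normedModType R) (f : V -> W)
    (a v : V) (t : R) (d : W) :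
  is_derive t 1 (fun s => f (a + s *: v)) d <-> is_derive (a + t *: v) v f d.
Proof.
have lineE (h : R) : a + (t + h *: 1) *: v = a + t *: v + h *: v.
  by rewrite [_%:A]mulr1 scalerDl addrA.
rewrite !is_deriveP; split => fd e e0; apply: filterS (fd _ e0) => h.
  by rewrite lineE.
by rewrite lineE.
Qed.

(** Locating [c] by [|c| <= |h|] instead of between 0 and [h] gives one statement for both signs of
    [h]. *)
Lemma MVT_line (R : realType) (V : normedModType R) (f : V -> R) (a v : V)
    (h : R) :
  (forall s : R, `|s| <= `|h| -> derivable f (a + s *: v) v) ->
  exists2 c : R, `|c| <= `|h| &
    f (a + h *: v) - f a = h * 'D_v f (a + c *: v).
Proof.
move=> df.
have dl (s : R) : `|s| <= `|h| ->
    is_derive s (1 : R) (fun s : R => f (a + s *: v)) ('D_v f (a + s *: v)).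
  by move=> /df fs; exact/is_derive_line/derivableP.
have cl (p q : R) : (forall s : R, p <= s <= q -> `|s| <= `|h|) ->
    {within `[p, q], continuous (fun s : R => f (a + s *: v))}.
  move=> pq; apply: derivable_within_continuous => s; rewrite in_itv/= => /pq.
  by move=> /dl fs; exact: (@ex_derive _ _ _ _ _ _ _ fs).
have [h0|h0] := leP 0 h.
  have sh (s : R) : 0 <= s <= h -> `|s| <= `|h|.
    by move=> /andP[s0 sh]; rewrite !ger0_norm.
  have dI (s : R) : s \in `]0, h[ ->
      is_derive s (1 : R) (fun s : R => f (a + s *: v)) ('D_v f (a + s *: v)).
    by rewrite in_itv/= => /andP[s0 s1]; apply/dl/sh; rewrite !ltW.
  have [c] := MVT_segment h0 dI (cl _ _ sh).
  rewrite in_itv/= => /sh ch; rewrite scale0r addr0 subr0 mulrC => ->.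
  by exists c.
have sh (s : R) : h <= s <= 0 -> `|s| <= `|h|.
  by move=> /andP[s0 sh]; rewrite !ler0_norm ?(ltW h0)// lerN2.
have dI (s : R) : s \in `]h, 0[ ->
    is_derive s (1 : R) (fun s : R => f (a + s *: v)) ('D_v f (a + s *: v)).
  by rewrite in_itv/= => /andP[s0 s1]; apply/dl/sh; rewrite !ltW.
have [c] := MVT_segment (ltW h0) dI (cl _ _ sh).
rewrite in_itv/= => /sh ch; rewrite scale0r addr0 => fh; exists c => //.
by rewrite -opprB fh sub0r mulrN opprK mulrC.
Qed.

(** Intermediate points from the mean value theorem are known only through a bound by the increment
    [h]; this makes a local property available at all of them at once. *)
Lemma near0_norm_le (R : realType) (V W : normedModType R) (C : R) (P : set V) :
  0 < C ->
  (\forall y \near (0 : V), P y) ->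
  \forall h \near (0 : W), forall y, `|y| <= C * `|h| -> P y.
Proof.
move=> C0 /nbhs_norm0P[r /= r0 rP]; apply/nbhs_norm0P.
exists (r / C) => /=; first exact: divr_gt0.
move=> h /= hr y yh; apply: rP; rewrite /= (le_lt_trans yh)//.
by rewrite mulrC -ltr_pdivlMr.
Qed.

Lemma evec_norm_le (R : realType) (n : nat) (i : 'I_n) : `|evec R i| <= 1.
Proof.
apply: mx_norm_le => // k l; rewrite mxE.
by case: (_ && _); rewrite ?normr1 ?normr0.
Qed.

Lemma Ck_continuous (R : realType) (n k : nat) (Omega : set 'cV[R]_n) f x :
  Ck k Omega f -> Omega x -> {for x, continuous f}.
Proof. by case: k => [|k] [fc _] Ox; exact: fc. Qed.

Lemma Ck_pred (R : realType) (n k : nat) (Omega : set 'cV[R]_n) f :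
  Ck k.+1 Omega f -> Ck k Omega f.
Proof.
elim: k f => [f [fc _]//|k IH f [fc fd]]; split => // i.
by have [fi] := fd i; split => //; exact: IH.
Qed.

Lemma near_add0 (R : realType) (V : normedModType R) (x : V) (P : set V) :
  (\forall y \near x, P y) -> \forall h \near (0 : V), P (x + h).
Proof.
move=> xP; rewrite (near_shift x); apply: filterS xP => y /=.
by rewrite sub0r addrC subrK.
Qed.

(* The increment is split along the coordinate directions, and the mean value
   theorem is applied in each of them. *)
Lemma C1_differentiable (R : realType) (n : nat) (Omega : set 'cV[R]_n)
    (f : 'cV[R]_n -> R) (x : 'cV[R]_n) :
  open Omega -> Ck 1 Omega f -> Omega x ->
  forall e : R, 0 < e -> \forall h \near (0 : 'cV[R]_n),
    `|f (x + h) - f x - \sum_i h i ord0 * partial i f x| <= e * `|h|.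
Proof.
move=> oO [_ fC] Ox e e0.
(* The error is shared among the [n] coordinates; [n.+1] keeps the divisor positive when [n = 0]. *)
pose e' := e / n.+1%:R.
have e'0 : 0 < e' by rewrite divr_gt0.
have Onear : \forall y \near x, Omega y by exact: open_nbhs_nbhs.
have : \forall y \near x, forall i, `|partial i f x - partial i f y| <= e'.
  apply: (@filter_forall _ _ _ _ (nbhs_filter x)) => i; have [_ [ic _]] := fC i.
  exact: ((cvgrPdist_le _ _).1 (ic _ Ox)).
move=> /(filterI Onear)/near_add0/(@near0_norm_le R _ 'cV[R]_n 1 _ ltr01).
apply: filterS => h hP.
(* [c m] keeps the first [m] coordinates of [h]: the points [x + c m] lead from [x] to [x + h]
   parallel to the axes, within sup norm distance [|h|] of [x]. *)
pose c m : 'cV[R]_n := \col_i (if (i < m)%N then h i ord0 else 0).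
have cS (k : 'I_n) : c k.+1 = c k + h k ord0 *: evec R k.
  apply/colP => i; rewrite !mxE ltnS leq_eqVlt andbT.
  have [->|ik] := eqVneq i k; first by rewrite eqxx ltnn add0r mulr1.
  by rewrite (inj_eq val_inj) (negbTE ik) mulr0 addr0.
have cle (k : 'I_n) (s : R) : `|s| <= `|h k ord0| ->
    `|c k + s *: evec R k| <= 1 * `|h|.
  move=> sh; rewrite mul1r; apply: mx_norm_le => // i j.
  rewrite !mxE !ord1 ?eqxx andbT.
  have [->|ik] := eqVneq i k.
    by rewrite ltnn add0r mulr1 (le_trans sh)// mx_entry_le.
  by rewrite mulr0 addr0; case: ifP; rewrite ?normr0// mx_entry_le.
have step (k : 'I_n) :
    `|f (x + c k.+1) - f (x + c k) - h k ord0 * partial k f x| <= e' * `|h|.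
  have [s sk|s sk] := @MVT_line _ _ f (x + c k) (evec R k) (h k ord0).
    rewrite -addrA; have [Oy _] := hP _ (cle _ _ sk).
    by have [fi _] := fC k; exact: fi.
  rewrite -addrA -cS => ->; rewrite -mulrBr normrM mulrC distrC.
  apply: ler_pM => //; last exact: mx_entry_le.
  by rewrite -addrA; have [_ ] := hP _ (cle _ _ sk); exact.
have c0 : c 0%N = 0 by apply/colP => i; rewrite !mxE.
have cn : c n = h by apply/colP => i; rewrite !mxE ltn_ord.
have -> : f (x + h) - f x = \sum_(i < n) (f (x + c i.+1) - f (x + c i)).
  rewrite -(big_mkord xpredT (fun i => f (x + c i.+1) - f (x + c i))).
  by rewrite (telescope_sumr (fun i => f (x + c i)))// c0 cn addr0.
rewrite -sumrB (le_trans (ler_norm_sum _ _ _))//.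
apply: (@le_trans _ _ (\sum_(i < n) e' * `|h|)); first exact: ler_sum.
rewrite sumr_const card_ord -mulr_natr mulrAC ler_wpM2r//.
by rewrite -mulrA ler_piMr ?(ltW e0)// mulrC ler_pdivrMr// mul1r ler_nat.
Qed.

Lemma is_derive_near_le (R : realType) (W : normedModType R) (g : R -> W)
    (t : R) (w : W) :
  is_derive t 1 g w ->
  \forall s \near t, `|g s - g t| <= (`|w| + 1) * `|s - t|.
Proof.
move=> /is_derive1P/(_ 1 ltr01); apply: filterS => s gs.
rewrite -(subrK ((s - t) *: w) (g s - g t)) (le_trans (ler_normD _ _))//.
by rewrite mulrDl addrC normrZ mulrC lerD2l.
Qed.

Lemma is_derive_entry (R : realType) (m n : nat) (g : R -> 'M[R]_(m, n)) (t : R)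
    (w : 'M[R]_(m, n)) i j :
  is_derive t 1 g w -> is_derive t 1 (fun s => g s i j) (w i j).
Proof.
move=> /is_derive1P gd; apply/is_derive1P => e /gd; apply: filterS => s.
apply: le_trans; have := mx_entry_le (g s - g t - (s - t) *: w) i j.
by rewrite !mxE.
Qed.

Lemma is_derive_mx (R : realType) (m n : nat) (g : R -> 'M[R]_(m, n)) (t : R)
    (w : 'M[R]_(m, n)) :
  (forall i j, is_derive t 1 (fun s => g s i j) (w i j)) -> is_derive t 1 g w.
Proof.
move=> gd; apply/is_derive1P => e e0.
have : \forall s \near t, forall p : 'I_m * 'I_n,
    `|g s p.1 p.2 - g t p.1 p.2 - (s - t) * w p.1 p.2| <= e * `|s - t|.
  apply: (@filter_forall _ _ _ _ (nbhs_filter t)) => -[i j] /=.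
  by have /is_derive1P/(_ _ e0) := gd i j.
apply: filterS => s gs; apply: mx_norm_le => [|i j].
  by rewrite mulr_ge0// ltW.
by rewrite !mxE; exact: (gs (i, j)).
Qed.

Lemma is_derive_continuous (R : realType) (W : normedModType R) (g : R -> W)
    (t : R) (w : W) :
  is_derive t 1 g w -> {for t, continuous g}.
Proof.
by move=> [gd _]; apply/differentiable_continuous/derivable1_diffP.
Qed.

Lemma frob_col (R : realType) (n : nat) (v w : 'cV[R]_n) :
  frob v w = \sum_i v i ord0 * w i ord0.
Proof. by apply: eq_bigr => i _; rewrite big_ord1. Qed.

Lemma frobB (R : realType) (m n : nat) (G X Y : 'M[R]_(m, n)) :
  frob G (X - Y) = frob G X - frob G Y.
Proof.
rewrite -sumrB; apply: eq_bigr => i _; rewrite -sumrB; apply: eq_bigr => j _.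
by rewrite !mxE mulrBr.
Qed.

Lemma frobZ (R : realType) (m n : nat) (G X : 'M[R]_(m, n)) (a : R) :
  frob G (a *: X) = a * frob G X.
Proof.
rewrite mulr_sumr; apply: eq_bigr => i _; rewrite mulr_sumr.
by apply: eq_bigr => j _; rewrite !mxE mulrCA.
Qed.

Lemma frob_le (R : realType) (m n : nat) (X Y : 'M[R]_(m, n)) :
  `|frob X Y| <= m%:R * n%:R * `|X| * `|Y|.
Proof.
rewrite (le_trans (ler_norm_sum _ _ _))//.
apply: (@le_trans _ _ (\sum_(i < m) n%:R * `|X| * `|Y|)); last first.
  by rewrite sumr_const card_ord -[leLHS]mulr_natl !mulrA.
apply: ler_sum => i _; rewrite (le_trans (ler_norm_sum _ _ _))//.
apply: (@le_trans _ _ (\sum_(j < n) `|X| * `|Y|)); last first.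
  by rewrite sumr_const card_ord -[leLHS]mulr_natl !mulrA.
by apply: ler_sum => j _; rewrite normrM ler_pM// mx_entry_le.
Qed.

Lemma is_derive_frob (R : realType) (m n : nat) (G : 'M[R]_(m, n))
    (g : R -> 'M[R]_(m, n)) (t : R) (w : 'M[R]_(m, n)) :
  is_derive t 1 g w -> is_derive t 1 (fun s => frob G (g s)) (frob G w).
Proof.
move=> /is_derive1P gw; apply/is_derive1P => e e0.
pose C := m%:R * n%:R * `|G| + 1.
have C0 : 0 < C by rewrite ltr_wpDl// !mulr_ge0.
apply: filterS (gw _ (divr_gt0 e0 C0)) => s gs.
rewrite -[_ *: _]frobZ -!frobB (le_trans (frob_le _ _))//.
apply: (@le_trans _ _ (C * (e / C * `|s - t|))); last first.
  by rewrite mulrA (mulrC C) divfK// gt_eqF.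
by rewrite ler_pM// ?mulr_ge0// lerDl.
Qed.

(** The set [A] of admissible increments allows an outer function that is differentiable only inside
    a subspace: it is [symm] for [H] and the whole space for C^1 functions. *)
Lemma is_derive_frob_comp (R : realType) (m n : nat) (f : 'M[R]_(m, n) -> R)
    (G : 'M[R]_(m, n)) (A : set 'M[R]_(m, n)) (g : R -> 'M[R]_(m, n)) (t : R)
    (w : 'M[R]_(m, n)) :
  (forall e : R, 0 < e -> \forall Y \near (0 : 'M[R]_(m, n)), A Y ->
    `|f (g t + Y) - f (g t) - frob G Y| <= e * `|Y|) ->
  (\forall s \near t, A (g s - g t)) -> is_derive t 1 g w ->
  is_derive t 1 (fun s => f (g s)) (frob G w).
Proof.
move=> fG gA gw; apply/is_derive1P => e e0.
pose C := `|w| + 1.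
have C0 : 0 < C by rewrite ltr_wpDl.
(* Half of [e] pays for the remainder of [f], where [|g s - g t| <= C * |s - t|], and half for the
   remainder of the linear part [frob G (g s)]. *)
have e2C : 0 < e / 2 / C by rewrite !divr_gt0.
have fd : \forall s \near t,
    `|f (g s) - f (g t) - frob G (g s - g t)| <= e / 2 / C * `|g s - g t|.
  have : g s - g t @[s --> t] --> (0 : 'M[R]_(m, n)).
    rewrite -(subrr (g t)); apply: cvgB; last exact: cvg_cst.
    exact: is_derive_continuous gw.
  move=> /(_ _ (fG _ e2C)) gl.
  have {gl} : \forall s \near t, A (g s - g t) ->
      `|f (g t + (g s - g t)) - f (g t) - frob G (g s - g t)|
      <= e / 2 / C * `|g s - g t| by exact: gl.
  apply: filterS2 gA => s gA; rewrite (addrC (g t)) subrK; exact.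
have Gd := (is_derive1P _ _ _).1 (is_derive_frob G gw) _
  (divr_gt0 e0 (ltr0Sn _ 1)).
have gd := is_derive_near_le gw.
near=> s.
rewrite -(subrK (frob G (g s - g t)) (f (g s) - f (g t))) -addrA.
rewrite (le_trans (ler_normD _ _))// (splitr e) mulrDl lerD//.
  apply: (@le_trans _ _ (e / 2 / C * `|g s - g t|)); first by near: s.
  rewrite -mulrA ler_wpM2l ?divr_ge0 ?(ltW e0)// mulrC ler_pdivrMr// mulrC.
  by near: s.
by rewrite frobB; near: s.
Unshelve. all: by end_near. Qed.

Lemma is_derive_C1_comp (R : realType) (n : nat) (Omega : set 'cV[R]_n)
    (f : 'cV[R]_n -> R) (g : R -> 'cV[R]_n) (t : R) (w : 'cV[R]_n) :
  open Omega -> Ck 1 Omega f -> Omega (g t) -> is_derive t 1 g w ->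
  is_derive t 1 (fun s => f (g s)) (frob (gradient f (g t)) w).
Proof.
move=> oO fC Og; apply: (@is_derive_frob_comp _ _ _ _ _ setT); last first.
  by apply: filterE.
move=> e e0; apply: filterS (C1_differentiable oO fC Og e0) => h + _.
rewrite frob_col; congr (`|_ - _| <= _).
by apply: eq_bigr => i _; rewrite mxE mulrC.
Qed.

(** * Symmetry of second partial derivatives *)

Lemma is_derive_shift (R : realType) (V W : normedModType R) (f : V -> W)
    (a b v : V) (d : W) :
  is_derive (a + b) v f d -> is_derive a v (fun y => f (y + b)) d.
Proof.
move=> /is_deriveP fd; apply/is_deriveP => e e0.
by apply: filterS (fd _ e0) => h; rewrite (addrAC a b).
Qed.

(** The mean value theorem is applied twice, to the difference [phi] along [evec R i] and then to
    [partial i f] along [evec R j]. The four values of [f] are symmetric in [i] and [j], the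
    derivative is not: comparing the two orders gives [partialC]. *)
Lemma second_difference (R : realType) (n : nat) (Omega : set 'cV[R]_n)
    (f : 'cV[R]_n -> R) (x : 'cV[R]_n) i j :
  open Omega -> Ck 2 Omega f -> Omega x ->
  forall e : R, 0 < e -> \forall s \near (0 : R),
    `|f (x + s *: evec R i + s *: evec R j) - f (x + s *: evec R i)
      - f (x + s *: evec R j) + f x
      - s * (s * partial j (partial i f) x)| <= e * (s * s).
Proof.
move=> oO [_ fC] Ox e e0.
have [fi [_ /(_ j)[fij fijC]]] := fC i.
have Onear : \forall y \near x, Omega y by exact: open_nbhs_nbhs.
have : \forall y \near x,
    `|partial j (partial i f) x - partial j (partial i f) y| <= e.
  exact: ((cvgrPdist_le _ _).1 (fijC.1 _ Ox)).
(* The factor 2 counts the two displacements from [x], each of length at most [|s|]. *)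
move=> /(filterI Onear)/near_add0/(@near0_norm_le R _ R 2 _ (ltr0Sn _ 1)).
apply: filterS => s sP.
have small (p q : R) : `|p| <= `|s| -> `|q| <= `|s| ->
    `|p *: evec R i + q *: evec R j| <= 2 * `|s|.
  move=> ps qs; rewrite (le_trans (ler_normD _ _))// !normrZ.
  rewrite mulr_natl mulr2n lerD// (le_trans (ler_piMr _ (evec_norm_le _ _)))//.
pose phi y := f (y + s *: evec R j) - f y.
have dphi (c : R) : `|c| <= `|s| ->
   is_derive (x + c *: evec R i) (evec R i) phi
     (partial i f (x + c *: evec R i + s *: evec R j)
      - partial i f (x + c *: evec R i)).
  move=> cs; apply: is_deriveB.
    apply: is_derive_shift; apply/derivableP/fi.
    by rewrite -addrA; have [] := sP _ (small _ _ cs (lexx _)).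
  apply/derivableP/fi; have [] := sP _ (small c 0 cs _); rewrite ?normr0//.
  by rewrite scale0r addr0.
have [c cs|c cs] := @MVT_line _ _ phi x (evec R i) s.
  by have [] := dphi _ cs.
rewrite (@derive_val _ _ _ _ _ _ _ (dphi _ cs)).
have [d ds|d ds] :=
  @MVT_line _ _ (partial i f) (x + c *: evec R i) (evec R j) s.
  apply: fij.
  by rewrite -addrA; have [] := sP _ (small _ _ cs ds).
move=> -> fE.
have phiE : f (x + s *: evec R i + s *: evec R j) - f (x + s *: evec R i)
    - f (x + s *: evec R j) + f x = phi (x + s *: evec R i) - phi x.
  by rewrite /phi opprB addrA addrAC.
rewrite phiE fE -/(partial j (partial i f) _).
rewrite -!mulrBr mulrA normrM mulrC distrC.
have ss : `|s * s| = s * s by rewrite ger0_norm// -expr2 sqr_ge0.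
rewrite ss ler_wpM2r//; first by rewrite -ss.
by rewrite -addrA; have [_] := sP _ (small _ _ cs ds).
Qed.

Lemma partialC (R : realType) (n : nat) (Omega : set 'cV[R]_n)
    (f : 'cV[R]_n -> R) (x : 'cV[R]_n) i j :
  open Omega -> Ck 2 Omega f -> Omega x ->
  partial i (partial j f) x = partial j (partial i f) x.
Proof.
move=> oO fC Ox; apply/eqP; rewrite -subr_eq0 -normr_le0.
apply/ler_addgt0Pl => e e0; rewrite addr0.
have aux (D p q fx s a b : R) :
    `|D - p - q + fx - s * (s * b)| <= e / 2 * (s * s) ->
    `|D - q - p + fx - s * (s * a)| <= e / 2 * (s * s) ->
    `|(a - b) * (s * s)| <= e * (s * s).
  move=> Db Da.
  have -> : (a - b) * (s * s) = (D - p - q + fx - s * (s * b))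
                              - (D - q - p + fx - s * (s * a)) by ring.
  by rewrite (le_trans (ler_normB _ _))// (splitr e) mulrDl lerD.
have e2 : 0 < e / 2 by rewrite divr_gt0.
have Dn := @filterI _ _ (nbhs_filter (0 : R)) _ _
                (second_difference i j oO fC Ox e2)
                (second_difference j i oO fC Ox e2).
(* One nonzero [s] satisfying both estimates is enough, since [s * s] can then be cancelled. *)
have [s [/= s0 [Dij Dji]]] :=
  filter_ex (filterI (nbhs_dnbhs_neq (0 : R))
    ((@nbhs_dnbhs R 0 : nbhs (0 : R) `<=` (0 : R)^') _ Dn)).
have ss : 0 < s * s by rewrite -expr2 exprn_even_gt0.
rewrite -(ler_pM2r ss) -[in leLHS](gtr0_norm ss) -normrM.
rewrite (addrAC x (s *: evec R j)) in Dji; exact: aux Dij Dji.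
Qed.

(** * The composite [x |-> H (hessian u x)] *)

Lemma Ck_partial (R : realType) (n k : nat) (Omega : set 'cV[R]_n) f i :
  Ck k.+1 Omega f -> Ck k Omega (partial i f).
Proof. by move=> [_ /(_ i)[]]. Qed.

(** The remainder in [is_sgradient] is measured by [enorm], derivatives by the sup norm; this
    comparison passes from the first to the second. *)
Lemma enorm_le (R : realType) (m n : nat) (X : 'M[R]_(m, n)) :
  enorm X <= Num.sqrt (m%:R * n%:R) * `|X|.
Proof.
rewrite -[X in _ <= _ * X]ger0_norm// -sqrtr_sqr -sqrtrM ?mulr_ge0//.
by rewrite ler_wsqrtr// expr2 mulrA (le_trans (ler_norm _))// frob_le.
Qed.

Lemma sgradientP (R : realType) (n : nat) (H : 'M[R]_n -> R) (X : 'M[R]_n) :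
  C1_symm H -> symm X -> is_sgradient H X (sgradient H X).
Proof. by move=> [HC _] /HC; exact: getPex. Qed.

Lemma symmB (R : realType) (n : nat) (X Y : 'M[R]_n) :
  symm X -> symm Y -> symm (X - Y).
Proof. by rewrite /symm/= linearB/= => -> ->. Qed.

Lemma is_derive_symm_comp (R : realType) (n : nat) (H : 'M[R]_n -> R)
    (X : R -> 'M[R]_n) (t : R) (Z : 'M[R]_n) :
  C1_symm H -> (\forall s \near t, symm (X s)) -> is_derive t 1 X Z ->
  is_derive t 1 (fun s => H (X s)) (frob (sgradient H (X t)) Z).
Proof.
move=> HC Xs XZ; have Xt : symm (X t) := nbhs_singleton Xs.
apply: (@is_derive_frob_comp _ _ _ _ _ (@symm R n)) XZ; last first.
  by apply: filterS Xs => s Xs; exact: symmB.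
move=> e e0; pose C := Num.sqrt (n%:R * n%:R : R) + 1.
have C0 : 0 < C by rewrite ltr_wpDl ?sqrtr_ge0.
have [_ /(_ _ (divr_gt0 e0 C0))] := sgradientP HC Xt.
rewrite near_withinE; apply: filterS => Y HY Ys; apply: le_trans (HY Ys) _.
rewrite -mulrA ler_wpM2l ?(ltW e0)// mulrC ler_pdivrMr// mulrC.
by rewrite (le_trans (enorm_le _))// ler_wpM2r// lerDl.
Qed.

Lemma hessian_symm (R : realType) (n : nat) (Omega : set 'cV[R]_n)
    (u : 'cV[R]_n -> R) (x : 'cV[R]_n) :
  open Omega -> Ck 2 Omega u -> Omega x -> symm (hessian u x).
Proof.
by move=> oO uC Ox; apply/matrixP => i j; rewrite !mxE (partialC _ _ oO uC Ox).
Qed.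

Lemma is_derive_H_hessian (R : realType) (n : nat) (H : 'M[R]_n -> R)
    (Omega : set 'cV[R]_n) (u : 'cV[R]_n -> R) (g : R -> 'cV[R]_n) (t : R)
    (w : 'cV[R]_n) :
  C1_symm H -> open Omega -> Ck 3 Omega u -> Omega (g t) ->
  is_derive t 1 g w ->
  is_derive t 1 (fun s => H (hessian u (g s)))
    (frob (sgradient H (hessian u (g t)))
       (\matrix_(i, j) frob (gradient (partial i (partial j u)) (g t)) w)).
Proof.
move=> HC oO uC Og gw; apply: is_derive_symm_comp => //.
  have gO : \forall s \near t, Omega (g s).
    have /(_ Omega) := is_derive_continuous gw; apply.
    exact: open_nbhs_nbhs.
  by apply: filterS gO => s; apply: hessian_symm => //; exact: Ck_pred.
apply: is_derive_mx => i j; rewrite mxE.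
under eq_fun do rewrite mxE.
by apply: is_derive_C1_comp oO _ Og gw; exact/Ck_partial/Ck_partial.
Qed.

Lemma frob_evec (R : realType) (n : nat) (v : 'cV[R]_n) k :
  frob v (evec R k) = v k ord0.
Proof.
rewrite frob_col (bigD1 k)//= mxE !eqxx mulr1 big1 ?addr0// => i ik.
by rewrite mxE (negbTE ik) mulr0.
Qed.

Lemma gradient_H_hessian (R : realType) (n : nat) (H : 'M[R]_n -> R)
    (Omega : set 'cV[R]_n) (u : 'cV[R]_n -> R) (x : 'cV[R]_n) k :
  C1_symm H -> open Omega -> Ck 3 Omega u -> Omega x ->
  gradient (fun y => H (hessian u y)) x k ord0 =
    frob (sgradient H (hessian u x)) (\matrix_(i, j) deriv3 u k i j x).
Proof.
move=> HC oO uC Ox; rewrite mxE /partial.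
have line : is_derive (0 : R) 1 (fun s : R => x + s *: evec R k) (evec R k).
  apply/is_derive1P => e e0; apply: filterE => s.
  by rewrite scale0r addr0 subr0 (addrC x) addrK subrr normr0 mulr_ge0// ltW.
have Ox0 : Omega (x + (0 : R) *: evec R k) by rewrite scale0r addr0.
have := is_derive_H_hessian HC oO uC Ox0 line.
move=> /(@is_derive_line _ _ _ (fun y => H (hessian u y))).
rewrite scale0r addr0 => /@derive_val ->.
by congr frob; apply/matrixP => i j; rewrite !mxE frob_evec mxE.
Qed.

(** Both expressions for the derivative expand into the same triple sum over [i], [j] and the
    coordinate [k] of [w]; only the order of summation differs. *)
Lemma is_derive_H_hessian_gradient (R : realType) (n : nat) (H : 'M[R]_n -> R)
    (Omega : set 'cV[R]_n) (u : 'cV[R]_n -> R) (g : R -> 'cV[R]_n) (t : R)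
    (w : 'cV[R]_n) :
  C1_symm H -> open Omega -> Ck 3 Omega u -> Omega (g t) ->
  is_derive t 1 g w ->
  is_derive t 1 (fun s => H (hessian u (g s)))
    (frob (gradient (fun y => H (hessian u y)) (g t)) w).
Proof.
move=> HC oO uC Og gw; have := is_derive_H_hessian HC oO uC Og gw.
congr is_derive.
rewrite frob_col; under [RHS]eq_bigr do
  rewrite (gradient_H_hessian _ HC oO uC Og) mulr_suml.
rewrite exchange_big/=; apply: eq_bigr => i _.
under [RHS]eq_bigr do rewrite mulr_suml.
rewrite exchange_big/=; apply: eq_bigr => j _.
rewrite mxE frob_col mulr_sumr; apply: eq_bigr => k _.
by rewrite !mxE mulrA.
Qed.

(** For fixed [i] and [j] the sums over [k], [l] and over [p], [q] separate, and by
    [gradient_H_hessian] they are the entries [i] and [j] of the gradient. *)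
Lemma A2inftyE (R : realType) (n : nat) (H : 'M[R]_n -> R)
    (Omega : set 'cV[R]_n) (u : 'cV[R]_n -> R) (x : 'cV[R]_n) :
  C1_symm H -> open Omega -> Ck 3 Omega u -> Omega x ->
  A2infty H u x =
    frob (gradient (fun y => H (hessian u y)) x) (vfield H u x).
Proof.
have aux (a b c d e : R) : a * b * c * d * e = b * d * (a * (c * e)) by ring.
move=> HC oO uC Ox; rewrite frob_col; apply: eq_bigr => i _.
rewrite [X in _ * X]mxE mulr_sumr; apply: eq_bigr => j _.
rewrite !(gradient_H_hessian _ HC oO uC Ox) /frob.
rewrite mulr_suml; apply: eq_bigr => k _.
rewrite mulr_suml; apply: eq_bigr => l _.
rewrite !mulr_sumr; apply: eq_bigr => p _.
rewrite !mulr_sumr; apply: eq_bigr => q _.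
rewrite [X in _ * X * (_ * (_ * _))]mxE [X in _ = _ * (_ * (_ * X))]mxE.
exact: aux.
Qed.

(** * Normalised vectors and continuity of the vector field *)

Lemma enorm_ge_entry (R : realType) (m n : nat) (X : 'M[R]_(m, n)) i j :
  `|X i j| <= enorm X.
Proof.
rewrite -sqrtr_sqr ler_wsqrtr// /frob (bigD1 i)//= (bigD1 j)//= expr2 -addrA.
rewrite lerDl addr_ge0//.
  by apply: sumr_ge0 => k _; rewrite -expr2 sqr_ge0.
by apply: sumr_ge0 => k _; apply: sumr_ge0 => l _; rewrite -expr2 sqr_ge0.
Qed.

Lemma norm_le_enorm (R : realType) (m n : nat) (X : 'M[R]_(m, n)) :
  `|X| <= enorm X.
Proof. by apply: mx_norm_le => [|i j]; rewrite ?sqrtr_ge0// enorm_ge_entry. Qed.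

Lemma enorm_eq0 (R : realType) (m n : nat) (X : 'M[R]_(m, n)) :
  (enorm X == 0) = (X == 0).
Proof.
apply/eqP/eqP => [X0|->].
  by apply/eqP; rewrite -normr_le0 -X0 norm_le_enorm.
apply/le_anti; rewrite sqrtr_ge0 andbT.
by rewrite (le_trans (enorm_le _))// normr0 mulr0.
Qed.

Lemma sgnv_norm_le1 (R : realType) (n : nat) (v : 'cV[R]_n) : `|sgnv v| <= 1.
Proof.
have [->|v0] := eqVneq v 0; first by rewrite /sgnv scaler0 normr0.
have v_gt0 : 0 < enorm v by rewrite lt_def enorm_eq0 v0 sqrtr_ge0.
rewrite normrZ normfV (gtr0_norm v_gt0) mulrC ler_pdivrMr// mul1r.
exact: norm_le_enorm.
Qed.

(** Both sides vanish at [v = 0], so the differential identity also covers times at which a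
    trajectory meets a zero of the field. *)
Lemma enorm_frob_sgnv (R : realType) (n : nat) (w v : 'cV[R]_n) :
  enorm v * frob w (sgnv v) = frob w v.
Proof.
rewrite -frobZ scalerA; have [->|v0] := eqVneq v 0; first by rewrite scaler0.
by rewrite mulfV ?scale1r// enorm_eq0.
Qed.

Lemma continuous_hessian (R : realType) (n : nat) (Omega : set 'cV[R]_n)
    (u : 'cV[R]_n -> R) (x : 'cV[R]_n) :
  Ck 2 Omega u -> Omega x -> {for x, continuous (hessian u)}.
Proof.
move=> uC Ox.
apply: (@cvg_mx_entry R _ (nbhs x) _ _ (hessian u) _ (nbhs_filter x)) => i j.
rewrite mxE.
under eq_fun do rewrite mxE.
exact: (Ck_continuous (Ck_partial i (Ck_partial j uC)) Ox).
Qed.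

Lemma continuous_sgradient_hessian (R : realType) (n : nat) (H : 'M[R]_n -> R)
    (Omega : set 'cV[R]_n) (u : 'cV[R]_n -> R) (x : 'cV[R]_n) :
  C1_symm H -> open Omega -> Ck 2 Omega u -> Omega x ->
  {for x, continuous (fun y => sgradient H (hessian u y))}.
Proof.
move=> [_ HC] oO uC Ox.
have HCx := (subspace_continuousP _ _).1 HC _ (hessian_symm oO uC Ox).
apply: (@cvg_comp _ _ _ (hessian u) (sgradient H) _ _ _ _ HCx).
move=> P; rewrite /within/= => hP.
have Onear : \forall y \near x, Omega y by exact: open_nbhs_nbhs.
have := continuous_hessian uC Ox hP.
apply: filterS2 Onear => y Oy; apply.
exact: hessian_symm oO uC Oy.
Qed.

Lemma cvg_sum_big (R : realType) (T I : Type) (F : set_system T) (r : seq I)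
    (f : I -> T -> R) (l : I -> R) :
  Filter F -> (forall i, f i @ F --> l i) ->
  \sum_(i <- r) f i x @[x --> F] --> \sum_(i <- r) l i.
Proof. by move=> FF fl; apply: cvg_big => //; exact: add_continuous. Qed.

Lemma continuous_vfield (R : realType) (n : nat) (H : 'M[R]_n -> R)
    (Omega : set 'cV[R]_n) (u : 'cV[R]_n -> R) (x : 'cV[R]_n) :
  C1_symm H -> open Omega -> Ck 3 Omega u -> Omega x ->
  {for x, continuous (vfield H u)}.
Proof.
move=> HC oO uC Ox.
apply: (@cvg_mx_entry R _ (nbhs x) _ _ (vfield H u) _ (nbhs_filter x)) => i j.
have -> : j = ord0 by exact: ord1.
pose G y := sgradient H (hessian u y).
(* The gradient in [vfield] is only a family of directional derivatives; [F] is its explicit form,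
   valid on the open set [Omega], and every factor in it is continuous. *)
pose F y := \sum_k G y i k * \sum_a \sum_b G y a b * deriv3 u k a b y.
have VF y : Omega y -> vfield H u y i ord0 = F y.
  move=> Oy; rewrite mxE; apply: eq_bigr => k _.
  rewrite (gradient_H_hessian _ HC oO uC Oy); congr (_ * _).
  by apply: eq_bigr => a _; apply: eq_bigr => b _; rewrite mxE.
have Gc a b : (fun y => G y a b) @ x --> G x a b.
  have Gx := continuous_sgradient_hessian HC oO (Ck_pred uC) Ox.
  have Mc := @coord_continuous R n n a b (G x).
  exact: (@cvg_comp _ _ _ G (fun M : 'M[R]_n => M a b) _ _ _ Gx Mc).
have Fc : F @ x --> F x.
  apply: (@cvg_sum_big _ _ _ (nbhs x)) => k; apply: cvgM; first exact: Gc.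
  apply: (@cvg_sum_big _ _ _ (nbhs x)) => a.
  apply: (@cvg_sum_big _ _ _ (nbhs x)) => b; apply: cvgM; first exact: Gc.
  by apply: (@Ck_continuous _ _ 0 Omega _ _ _ Ox); do 3!apply: Ck_partial.
move: Fc; clearbody F; rewrite -(VF _ Ox); apply: cvg_trans; apply: near_eq_cvg.
have Onear : \forall y \near x, Omega y by exact: open_nbhs_nbhs.
by apply: filterS Onear => y /VF ->.
Qed.

(** * Peano's existence theorem *)

Lemma ultra_fmap (T U : Type) (f : T -> U) (F : set_system T) :
  UltraFilter F -> UltraFilter (f @ F).
Proof.
move=> FU; split; first exact: fmap_proper_filter.
move=> G GP FG; apply/seteqP; split => // A GA.
have [//|FnA] := in_ultra_setVsetC (f @^-1` A) FU.
have /filterI/(_ GA) : G (~` A) by exact: FG.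
by rewrite setICl => /filter_not_empty.
Qed.

Definition euler (R : realType) (n : nat) (F : 'cV[R]_n -> 'cV[R]_n)
    (x : 'cV[R]_n) (h : R) (j : nat) : 'cV[R]_n :=
  iter j (fun y => y + h *: F y) x.

(** Each step equals [h *: v] up to an error [h * e], and the errors add up. The case [v = 0],
    [e = 1] gives the Lipschitz bound below. *)
Lemma euler_increment (R : realType) (n : nat) (F : 'cV[R]_n -> 'cV[R]_n)
    (x : 'cV[R]_n) (h : R) (v : 'cV[R]_n) (e : R) (a b : nat) :
  0 < h -> (a <= b)%N ->
  (forall j, (a <= j < b)%N -> `|F (euler F x h j) - v| <= e) ->
  `|euler F x h b - euler F x h a - ((b%:R - a%:R) * h) *: v|
    <= (b%:R - a%:R) * h * e.
Proof.
set y := euler F x h; move=> h0.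
have yS j : y j.+1 = y j + h *: F (y j) by [].
move=> /subnKC <-; elim: (b - a)%N => [_|m IH Fv].
  by rewrite addn0 !subrr !mul0r scale0r subr0 normr0.
have -> : y (a + m.+1)%N - y a - (((a + m.+1)%:R - a%:R) * h) *: v =
   (y (a + m)%N - y a - (((a + m)%:R - a%:R) * h) *: v)
   + h *: (F (y (a + m)%N) - v).
  rewrite addnS yS -natr1 (addrAC _ 1) mulrDl mul1r scalerDl.
  rewrite scalerBr opprD !addrA; congr (_ - _).
  by rewrite (addrAC (y _)) addrAC.
have -> : ((a + m.+1)%:R - a%:R) * h * e
    = ((a + m)%:R - a%:R) * h * e + h * e :> R.
  by rewrite addnS -natr1; ring.
rewrite (le_trans (ler_normD _ _))// lerD//.
  apply: IH => j /andP[aj jb]; apply: Fv.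
  by rewrite aj addnS ltnS ltnW.
by rewrite normrZ (gtr0_norm h0) ler_wpM2l ?(ltW h0)// Fv// leq_addr addnS /=.
Qed.

Lemma euler_lipschitz (R : realType) (n : nat) (F : 'cV[R]_n -> 'cV[R]_n)
    (x : 'cV[R]_n) (h : R) (a b : nat) :
  0 < h -> (forall z, `|F z| <= 1) ->
  `|euler F x h b - euler F x h a| <= `|b%:R - a%:R| * h.
Proof.
move=> h0 F1.
wlog ab : a b / (a <= b)%N => [wl|].
  by have [/wl//|/ltnW/wl] := leqP a b; rewrite distrC (distrC b%:R).
have := @euler_increment _ _ F x h 0 1 _ _ h0 ab.
rewrite scaler0 subr0 mulr1 ger0_norm ?subr_ge0 ?ler_nat//; apply => j _.
by rewrite subr0.
Qed.

(* Step functions are used instead of polygons: the ultralimit below is taken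
   pointwise, so the approximations need not be continuous. *)
Definition euler_step (R : realType) (n : nat) (F : 'cV[R]_n -> 'cV[R]_n)
    (x : 'cV[R]_n) (h : R) (t : R) :=
  euler F x h (Num.truncn (t / h)).

Lemma truncn_step (R : realType) (h t : R) : 0 < h -> 0 <= t ->
  `|(Num.truncn (t / h))%:R * h - t| <= h.
Proof.
move=> h0 t0; have /andP[tl tr] := truncn_itv (divr_ge0 t0 (ltW h0)).
rewrite distrC ler_norml; move: tl tr.
rewrite ler_pdivlMr// ltr_pdivrMr// -natr1 => tl tr.
by apply/andP; split; lra.
Qed.

(** Rounding [s] and [t] to the grid moves each by at most [h]: hence the duration [|s - t| + 2 * h]
    of the Euler steps, which by the Lipschitz bound is also the radius of a ball containing them,
    and the error [2 * h * |v|] in the linear term. *)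
Lemma euler_step_increment (R : realType) (n : nat) (F : 'cV[R]_n -> 'cV[R]_n)
    (x : 'cV[R]_n) (h : R) (v : 'cV[R]_n) (e s t : R) :
  0 < h -> (forall z, `|F z| <= 1) ->
  0 <= e -> 0 <= s -> 0 <= t ->
  (forall z, `|z - euler_step F x h t| <= `|s - t| + 2 * h ->
    `|F z - v| <= e) ->
  `|euler_step F x h s - euler_step F x h t - (s - t) *: v|
    <= (`|s - t| + 2 * h) * e + 2 * h * `|v|.
Proof.
move=> h0 F1 e0 s0 t0 Fv; rewrite /euler_step in Fv *.
have := truncn_step h0 s0; have := truncn_step h0 t0.
set y := euler F x h in Fv *.
move: Fv; set a := Num.truncn (t / h); set b := Num.truncn (s / h) => Fv ta sb.
have ab : `|(b%:R - a%:R) * h - (s - t)| <= 2 * h.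
  have -> : (b%:R - a%:R) * h - (s - t) = (b%:R * h - s) - (a%:R * h - t).
    by ring.
  by rewrite (le_trans (ler_normB _ _))// [2 * h]mulr_natl mulr2n lerD.
have abh : `|b%:R - a%:R| * h <= `|s - t| + 2 * h.
  have -> : `|b%:R - a%:R| * h = `|(b%:R - a%:R) * h - (s - t) + (s - t)|.
    by rewrite subrK normrM (gtr0_norm h0).
  by rewrite (le_trans (ler_normD _ _))// addrC lerD2l.
have Fj j : `|j%:R - a%:R| <= `|b%:R - a%:R| :> R -> `|F (y j) - v| <= e.
  move=> jab; apply: Fv; rewrite (le_trans (euler_lipschitz _ _ _ h0 F1))//.
  by rewrite (le_trans _ abh)// ler_wpM2r// ltW.
have inc : `|y b - y a - ((b%:R - a%:R) * h) *: v| <= `|b%:R - a%:R| * h * e.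
  have [ab'|/ltnW ba] := leqP a b.
    rewrite [X in _ <= X * _ * _]ger0_norm ?subr_ge0 ?ler_nat//.
    apply: euler_increment => // j /andP[aj jb]; apply: Fj.
    by rewrite !ger0_norm ?subr_ge0 ?ler_nat// lerD2r ler_nat ltnW.
  have -> : y b - y a - ((b%:R - a%:R) * h) *: v
      = - (y a - y b - ((a%:R - b%:R) * h) *: v).
    by rewrite [RHS]opprB opprB [RHS]addrC -scaleNr -mulNr opprB.
  rewrite normrN (distrC b%:R).
  rewrite [X in _ <= X * _ * _]ger0_norm ?subr_ge0 ?ler_nat//.
  apply: euler_increment => // j /andP[bj ja]; apply: Fj.
  by rewrite !ler0_norm ?subr_le0 ?ler_nat ?(ltnW ja)// lerN2 lerD2r ler_nat.
have -> : y b - y a - (s - t) *: v = (y b - y a - ((b%:R - a%:R) * h) *: v)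
    + ((b%:R - a%:R) * h - (s - t)) *: v.
  by rewrite [in RHS]scalerBl addrA subrK.
rewrite (le_trans (ler_normD _ _))// lerD//.
  by rewrite (le_trans inc)// ler_wpM2r.
by rewrite normrZ ler_wpM2r.
Qed.


(** By compactness of [[-M, M]], one ultrafilter gives limits at all times simultaneously, in place
    of the extraction of subsequences. *)
Lemma cvg_ultra_bounded (R : realType) (T : Type) (U : set_system T)
    (f : T -> R) (M : R) :
  UltraFilter U -> (forall k, `|f k| <= M) -> exists l : R, f @ U --> l.
Proof.
move=> UU fM; have := @segment_compact R (- M) M.
rewrite compact_ultra => /(_ (f @ U) (ultra_fmap f UU)) [|l [_ fl]].
  by apply: (@filterE _ U) => k /=; rewrite in_itv/= -ler_norml fM.
by exists l.
Qed.

(* Only continuity of [F] at the point [g t] enters the derivative at [t]: the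
   Euler points near [t] stay within [|s - t|] of [g t], where [F] is almost
   constant, and this estimate survives the pointwise limit along an
   ultrafilter. *)
Lemma peano_right (R : realType) (n : nat) (F : 'cV[R]_n -> 'cV[R]_n)
    (x : 'cV[R]_n) :
  (forall z, `|F z| <= 1) ->
  exists g : R -> 'cV[R]_n,
  [/\ g 0 = x,
      forall t, 0 <= t -> `|g t - x| <= t
    & forall t, 0 <= t -> {for g t, continuous F} ->
        forall e : R, 0 < e -> \forall s \near t, 0 <= s ->
          `|g s - g t - (s - t) *: F (g t)| <= e * `|s - t|].
Proof.
move=> F1.
have [U [UU oU]] := ultraFilterLemma eventually_filter.
pose h k : R := k.+1%:R^-1.
have h0 k : 0 < h k by rewrite invr_gt0.
pose Y k t := euler_step F x (h k) t.
have Y0 k : Y k 0 = x by rewrite /Y /euler_step mul0r truncn0.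
have YB k (t : R) : 0 <= t -> `|Y k t - x| <= t.
  move=> t0; rewrite -[x in X in X <= _](Y0 k) /Y /euler_step.
  rewrite (le_trans (euler_lipschitz _ _ _ (h0 k) F1))// mul0r truncn0 subr0.
  rewrite ger0_norm// -ler_pdivlMr//.
  by have /andP[] := truncn_itv (divr_ge0 t0 (ltW (h0 k))).
have ex (t : R) : 0 <= t -> exists l : 'cV[R]_n, (fun k => Y k t) @ U --> l.
  move=> t0.
  have Yi i : exists l : R, (fun k => Y k t i ord0) @ U --> l.
    apply: (@cvg_ultra_bounded _ _ _ _ (t + `|x|)) => k.
    rewrite -(subrK x (Y k t)) mxE (le_trans (ler_normD _ _))// lerD//.
      by rewrite (le_trans (mx_entry_le _ _ _)) ?YB.
    exact: mx_entry_le.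
  exists (\col_i sval (cid (Yi i))); apply: cvg_mx_entry => i j.
  have -> : j = ord0 by exact: ord1.
  by rewrite mxE; case: cid.
pose g (t : R) :=
  if pselect (0 <= t) is left t0 then sval (cid (ex t t0)) else x.
have gl (t : R) : 0 <= t -> (fun k => Y k t) @ U --> g t.
  by move=> t0; rewrite /g; case: pselect => // t0'; case: cid.
exists g; split.
- have := gl 0 (lexx 0); under eq_fun do rewrite Y0.
  by move=> /(cvg_unique _); apply=> //; exact: cvg_cst.
- move=> t t0; apply/ler_addgt0Pl => e e0.
  have [k /= Yk] := filter_ex ((cvgrPdist_le _ _).1 (gl _ t0) _ e0).
  rewrite -(subrK (Y k t) (g t)) -addrA (le_trans (ler_normD _ _))// lerD//.
  exact: YB.
move=> t t0 Fc e e0.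
have [d /= d0 Fd] := (nbhs_normP _ _).1 ((cvgrPdist_le _ _).1 Fc _ e0).
have d4 : 0 < d / 4 by rewrite divr_gt0.
have : \forall s \near t, `|t - s| < d / 4 by apply/nbhs_normP; exists (d / 4).
apply: filterS => s; rewrite distrC => st s0.
set v := F (g t) in Fd *.
(* The slack [eta] absorbs the discretisation: a quarter for each of the limits at [s] and [t], a
   half for the mesh. The index [k] is chosen after [s], so pointwise convergence suffices. *)
apply/ler_addgt0Pl => eta eta0.
have eta4 : 0 < eta / 4 by rewrite divr_gt0.
(* With [h k < d / 8] the ball of radius [|s - t| + 2 * h k] around [Y k t] stays within [d] of
   [g t]; the second bound gives [2 * h k * (e + |v|) <= eta / 2]. *)
pose c := Num.min (d / 8) (eta / 4 / (e + `|v|)).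
have c0 : 0 < c by rewrite lt_min !divr_gt0// ltr_pwDl.
have hc : \forall k \near U, h k < c.
  by apply: oU; exact: (near_infty_natSinv_lt (PosNum c0)).
have Ynear r b : 0 <= r -> 0 < b -> \forall k \near U, `|g r - Y k r| <= b.
  by move=> /gl/cvgrPdist_le; exact.
have Yt := Ynear _ _ t0 d4.
have Yt' := Ynear _ _ t0 eta4.
have Ys := Ynear _ _ s0 eta4.
have [k [[{}hc {}Yt] [{}Yt' {}Ys]]] :=
  filter_ex (filterI (filterI hc Yt) (filterI Yt' Ys)).
rewrite /= in hc Yt Yt' Ys.
move: hc; rewrite lt_min => /andP[hd he].
have key : `|Y k s - Y k t - (s - t) *: v|
    <= (`|s - t| + 2 * h k) * e + 2 * h k * `|v|.
  apply: euler_step_increment => //; first exact: ltW.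
  move=> z zt; rewrite distrC; apply: Fd => /=.
  rewrite -(subrK (Y k t) (g t)) -addrA (le_lt_trans (ler_normD _ _))//.
  have -> : d = d / 4 + d * (3 / 4) by field.
  by rewrite ler_ltD// distrC (le_lt_trans zt)//; lra.
have hv : 2 * h k * (e + `|v|) <= eta / 2.
  by move: he; rewrite ltr_pdivlMr ?ltr_pwDl// => he; lra.
have -> : g s - g t - (s - t) *: v =
   (Y k s - Y k t - (s - t) *: v) + ((g s - Y k s) - (g t - Y k t)).
  by apply/matrixP => i j; rewrite !mxE; ring.
rewrite (le_trans (ler_normD _ _))//.
have := le_trans (ler_normB _ _) (lerD Ys Yt').
by lra.
Qed.

(** Negative times are the forward problem for [- F] run backwards. The one-sided estimates of
    [peano_right] include [t = 0], so the two halves join there with a genuine derivative. *)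
Lemma peano (R : realType) (n : nat) (F : 'cV[R]_n -> 'cV[R]_n) (x : 'cV[R]_n) :
  (forall z, `|F z| <= 1) ->
  exists g : R -> 'cV[R]_n,
  [/\ g 0 = x,
      forall t, `|g t - x| <= `|t|
    & forall t, {for g t, continuous F} -> is_derive t 1 g (F (g t))].
Proof.
move=> F1; have [gp [gp0 gpB gpF]] := peano_right x F1.
have N1 z : `|- F z| <= 1 by rewrite normrN.
have [gm [gm0 gmB gmF]] := @peano_right _ _ (fun z => - F z) x N1.
pose g (t : R) := if 0 <= t then gp t else gm (- t).
have gP (t : R) : 0 <= t -> g t = gp t by rewrite /g => ->.
have gN (t : R) : t <= 0 -> g t = gm (- t).
  rewrite /g; case: ltgtP => // -> _; first by rewrite oppr0 gp0 gm0.
have g0 : g 0 = x by rewrite gP.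
have right (t : R) : 0 <= t -> {for g t, continuous F} ->
    forall e : R, 0 < e -> \forall s \near t, 0 <= s ->
      `|g s - g t - (s - t) *: F (g t)| <= e * `|s - t|.
  move=> t0; rewrite gP// => Fc e e0.
  by apply: filterS (gpF _ t0 Fc _ e0) => s gs s0; rewrite gP// gs.
have left (t : R) : t <= 0 -> {for g t, continuous F} ->
    forall e : R, 0 < e -> \forall s \near t, s <= 0 ->
      `|g s - g t - (s - t) *: F (g t)| <= e * `|s - t|.
  move=> t0; rewrite gN// => Fc e e0.
  have Nt0 : 0 <= - t by rewrite oppr_ge0.
  have Nc : {for gm (- t), continuous (fun z => - F z)}.
    exact: (@cvgN _ _ _ _ _ F _ Fc).
  have /nearN := gmF _ Nt0 Nc _ e0; apply: filterS => s gs s0; rewrite gN//.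
  have := gs; rewrite oppr_ge0 => /(_ s0).
  by rewrite -opprD scalerN scaleNr opprK normrN.
exists g; split => // [t|t Fc].
  have [t0|/ltW t0] := leP 0 t; first by rewrite gP// ger0_norm// gpB.
  by rewrite gN// ler0_norm// gmB// oppr_ge0.
apply/is_derive1P => e e0.
have [t0|t0|t0] := ltgtP 0 t.
- have := right _ (ltW t0) Fc _ e0.
  by apply: filterS2 (lt_nbhsr t0) => s s0; apply; exact: ltW.
- have := left _ (ltW t0) Fc _ e0.
  by apply: filterS2 (lt_nbhsl t0) => s s0; apply; exact: ltW.
- rewrite -t0 in Fc *.
  apply: filterS2 (right _ (lexx 0) Fc _ e0) (left _ (lexx 0) Fc _ e0) => s.
  by move=> gr gl; have [/gr|/ltW/gl] := leP 0 s.
Qed.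

(** * Trajectories *)

Lemma continuous_sgnv (R : realType) (n : nat) (v : 'cV[R]_n) :
  v != 0 -> {for v, continuous (@sgnv R n)}.
Proof.
move=> v0.
have frobc : (fun w : 'cV[R]_n => frob w w) @ v --> frob v v.
  have vc i : (fun w : 'cV[R]_n => w i ord0) @ v --> v i ord0.
    exact: coord_continuous.
  rewrite frob_col; under eq_fun do rewrite frob_col.
  by apply: (@cvg_sum_big _ _ _ (nbhs v)) => i; exact: cvgM.
have ec : (fun w : 'cV[R]_n => enorm w) @ v --> enorm v.
  exact: (@cvg_comp _ _ _ (fun w : 'cV[R]_n => frob w w) Num.sqrt _ _ _ frobc
           (@sqrt_continuous R _)).
have iv : (fun w : 'cV[R]_n => (enorm w)^-1) @ v --> (enorm v)^-1.
  apply: (@cvg_comp _ _ _ (fun w : 'cV[R]_n => enorm w) GRing.inv _ _ _ ec).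
  by apply: inv_continuous; rewrite enorm_eq0.
exact: (cvgZ iv cvg_id).
Qed.

Lemma is_derive0_cst (R : realType) (f : R -> R) (r : R) :
  (forall t : R, `|t| < r -> is_derive t 1 f 0) ->
  forall t : R, `|t| < r -> f t = f 0.
Proof.
move=> fd t tr.
have [c ct|c ct] := @MVT_line R R f 0 1 t.
  have cr := le_lt_trans ct tr.
  by rewrite add0r [_%:A]mulr1; have [] := fd _ cr.
have [_ f0] := fd _ (le_lt_trans ct tr).
by rewrite !add0r ![_%:A]mulr1 f0 mulr0 => /eqP; rewrite subr_eq0 => /eqP.
Qed.

(* Needed at [t = 0], where a trajectory is not assumed to be differentiable. *)
Lemma is_derive_cvg_derivative (R : realType) (m n : nat)
    (g g' : R -> 'M[R]_(m, n)) (t : R) :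
  (\forall s \near t, {for s, continuous g}) ->
  (\forall s \near t, s != t -> is_derive s 1 g (g' s)) ->
  {for t, continuous g'} -> is_derive t 1 g (g' t).
Proof.
move=> gc gd g'c; apply: is_derive_mx => i j; apply/is_derive1P => e e0.
have g'n : \forall s \near t, `|g' t - g' s| <= e.
  exact: ((cvgrPdist_le _ _).1 g'c).
have [d /= d0 dP] := (nbhs_normP _ _).1 (@filterI _ _ (nbhs_filter t) _ _
  (@filterI _ _ (nbhs_filter t) _ _ gc gd) g'n).
apply/nbhs_normP; exists d => //= s sd.
(* Subtracting the expected tangent leaves a function with derivative at most [e] in absolute value
   off [t]. The mean value theorem then applies between [s] and [t], since it asks for derivatives
   only in the open interval. *)
pose f r := g r i j - r * g' t i j.
have fd (r : R) : `|t - r| < d -> r != t ->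
    is_derive r 1 f (g' r i j - g' t i j).
  move=> /dP[[_ gr] _] /gr gr'; apply: is_deriveB; first exact: is_derive_entry.
  apply/is_derive1P => eta eta0; apply: filterE => z.
  by rewrite -!mulrBl subrr mul0r normr0 mulr_ge0// ltW.
have fc (r : R) : `|t - r| < d -> {for r, continuous f}.
  move=> /dP[[gr _] _]; apply: cvgB; last by apply: cvgMl; exact: cvg_id.
  exact: (@cvg_comp _ _ _ g (fun M : 'M[R]_(m, n) => M i j) _ _ _ gr
           (@coord_continuous R m n i j _)).
have fb (r : R) : `|t - r| < d -> `|g' r i j - g' t i j| <= e.
  move=> /dP[_ rd]; rewrite distrC (le_trans _ rd)//.
  by have := mx_entry_le (g' t - g' r) i j; rewrite !mxE.
have -> : g s i j - g t i j - (s - t) *: g' t i j = f s - f t.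
  by rewrite /f [_ *: _]mulrBl; ring.
have inc (a b : R) : a < b -> (forall r : R, a <= r <= b -> `|t - r| < d) ->
    (forall r : R, a < r < b -> r != t) -> `|f b - f a| <= e * (b - a).
  move=> ab abd abt.
  have fab (r : R) : r \in `]a, b[ -> is_derive r 1 f (g' r i j - g' t i j).
    rewrite in_itv/= => /andP[ar rb].
    by apply: fd; [rewrite abd// !ltW|rewrite abt// ar].
  have cab : {within `[a, b], continuous f}.
    apply: continuous_in_subspaceT => r; rewrite inE/= in_itv/= => /abd.
    exact: fc.
  have [r] := MVT ab fab cab; rewrite in_itv/= => /andP[ar rb] ->.
  rewrite normrM [`|b - a|]gtr0_norm ?subr_gt0//.
  by rewrite ler_wpM2r ?subr_ge0 ?(ltW ab)//; apply/fb/abd; rewrite !ltW.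
have [st|ts|->] := ltgtP s t; last by rewrite !subrr normr0 mulr0.
- rewrite distrC (distrC s) [X in _ <= e * X]gtr0_norm ?subr_gt0//.
  apply: inc => // r /andP[sr rt].
    apply: le_lt_trans sd; rewrite !ger0_norm ?subr_ge0 ?(ltW st)//.
    by rewrite lerD2l lerN2.
  by rewrite lt_eqF.
- rewrite [X in _ <= e * X]gtr0_norm ?subr_gt0//.
  apply: inc => // r /andP[tr rs].
    apply: le_lt_trans sd; rewrite !ler0_norm ?subr_le0 ?(ltW ts)//.
    by rewrite lerN2 lerD2l lerN2.
  by rewrite gt_eqF.
Qed.

(** The condition [vfield H u x != 0] serves at [t = 0]: it makes the normalised field continuous at
    [x], so the derivative has a limit there. *)
Lemma is_derive_trajectory (R : realType) (n : nat) (H : 'M[R]_n -> R)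
    (Omega : set 'cV[R]_n) (u : 'cV[R]_n -> R) (x : 'cV[R]_n)
    (a b : R) (g : R -> 'cV[R]_n) (t : R) :
  C1_symm H -> open Omega -> Ck 3 Omega u -> vfield H u x != 0 -> Omega x ->
  is_trajectory Omega (vfield H u) x a b g -> t \in `]a, b[ ->
  is_derive t 1 g (sgnv (vfield H u (g t))).
Proof.
move=> HC1 Oopen uC3 Vx Ox [/andP[a0 b0] gO gd g0] tab.
have der (s : R) : s \in `]a, b[ -> s != 0 ->
    is_derive s 1 g (sgnv (vfield H u (g s))).
  move=> sab s0; have [gs <-] := gd s sab s0.
  by rewrite derive1E; exact/derivableP.
have [t0|t0] := eqVneq t 0; last exact: der.
have nearab : \forall s \near (0 : R), s \in `]a, b[.
  by apply: near_in_itvoo; rewrite in_itv/= a0.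
rewrite t0.
apply: (@is_derive_cvg_derivative _ _ _ g (fun s => sgnv (vfield H u (g s)))).
- by apply: filterS nearab => s /gO[].
- by apply: filterS nearab => s sab; exact: der.
have gc : {for 0, continuous g} by rewrite -t0; have [] := gO t tab.
have Vc : (fun s => vfield H u (g s)) @ (0 : R) --> vfield H u (g 0).
  apply: (@cvg_comp _ _ _ g (vfield H u) _ _ _ gc).
  by rewrite g0; exact: continuous_vfield HC1 Oopen uC3 Ox.
apply: (@cvg_comp _ _ _ (fun s => vfield H u (g s)) (@sgnv R n) _ _ _ Vc).
by rewrite g0; exact: continuous_sgnv.
Qed.

Lemma trajectory_identity (R : realType) (n : nat) (H : 'M[R]_n -> R)
    (Omega : set 'cV[R]_n) (u : 'cV[R]_n -> R) (x : 'cV[R]_n)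
    (a b : R) (g : R -> 'cV[R]_n) (t : R) :
  C1_symm H -> open Omega -> Ck 3 Omega u -> vfield H u x != 0 -> Omega x ->
  is_trajectory Omega (vfield H u) x a b g -> t \in `]a, b[ ->
  derivable (fun s => H (hessian u (g s))) t 1 /\
  enorm (vfield H u (g t)) * derive1 (fun s => H (hessian u (g s))) t =
    A2infty H u (g t).
Proof.
move=> HC1 Oopen uC3 Vx Ox traj tab.
have gt := is_derive_trajectory HC1 Oopen uC3 Vx Ox traj tab.
have [_ /(_ t tab)[Og _] _ _] := traj.
have [Hd HD] := is_derive_H_hessian_gradient HC1 Oopen uC3 Og gt.
split => //; rewrite derive1E HD enorm_frob_sgnv.
by rewrite -(A2inftyE HC1 Oopen uC3 Og).
Qed.

Lemma exists_trajectory (R : realType) (n : nat) (H : 'M[R]_n -> R)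
    (Omega : set 'cV[R]_n) (u : 'cV[R]_n -> R) (x : 'cV[R]_n) :
  C1_symm H -> open Omega -> Ck 3 Omega u ->
  (forall y, Omega y -> A2infty H u y = 0) ->
  Omega x -> vfield H u x != 0 ->
  exists (eps : R) (g : R -> 'cV[R]_n),
    [/\ 0 < eps, is_trajectory Omega (vfield H u) x (- eps) eps g,
        C1_curve (- eps) eps g
      & forall t : R, `|t| < eps -> H (hessian u (g t)) = H (hessian u x)].
Proof.
move=> HC1 Oopen uC3 A0 Ox Vx; pose F y := sgnv (vfield H u y).
have [g [g0 gB gF]] := peano x (fun z => sgnv_norm_le1 (vfield H u z)).
have Vc := continuous_vfield HC1 Oopen uC3 Ox.
have Onear : \forall y \near x, Omega y by exact: open_nbhs_nbhs.
have Vnear : \forall y \near x, vfield H u y != 0 by exact: cvgr_neq0 Vc Vx.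
(* The curve moves with speed at most 1, so the radius [r] of a ball around [x] inside [Omega] and
   free of zeros of the field is also a valid lifetime. *)
have [r /= r0 rP] := (nbhs_normP _ _).1
  (@filterI _ _ (nbhs_filter x) _ _ Onear Vnear).
have gr (t : R) : `|t| < r -> Omega (g t) /\ vfield H u (g t) != 0.
  by move=> tr; apply: rP => /=; rewrite distrC (le_lt_trans (gB t)).
have itvE (t : R) : (t \in `](- r), r[) = (`|t| < r).
  by rewrite in_itv/= ltr_norml.
have Fc (t : R) : `|t| < r -> {for g t, continuous F}.
  move=> /gr[Ot Vt].
  exact: (@cvg_comp _ _ _ (vfield H u) (@sgnv R n) _ _ _
    (continuous_vfield HC1 Oopen uC3 Ot) (continuous_sgnv Vt)).
have gd (t : R) : `|t| < r -> is_derive t 1 g (F (g t)) by move=> /Fc /gF.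
have gc (t : R) : `|t| < r -> {for t, continuous g}.
  by move=> /gd; exact: is_derive_continuous.
exists r, g; split; first exact: r0.
- split; last exact: g0.
  + by rewrite oppr_lt0 r0.
  + by move=> t; rewrite itvE => tr; split; [have [] := gr _ tr|exact: gc].
  + by move=> t; rewrite itvE => /gd[gt gt'] _; rewrite derive1E.
- move=> t tr; have := tr; rewrite itvE => tr'.
  split; first by have [] := gd _ tr'.
  have Fg : (fun s => F (g s)) @ t --> F (g t).
    exact: (@cvg_comp _ _ _ g F _ _ _ (gc _ tr') (Fc _ tr')).
  have g't : derive1 g t = F (g t) by rewrite derive1E; have [_] := gd _ tr'.
  suff : derive1 g @ t --> derive1 g t by [].
  rewrite g't; apply: cvg_trans Fg; apply: near_eq_cvg.
  apply: filterS (near_in_itvoo tr) => s.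
  by rewrite itvE => /gd[_]; rewrite derive1E.
move=> t tr; rewrite -g0.
apply: (@is_derive0_cst _ (fun s => H (hessian u (g s))) r) tr => s sr.
have [Os Vs] := gr _ sr.
have := is_derive_H_hessian_gradient HC1 Oopen uC3 Os (gd _ sr).
congr is_derive.
(* The derivative times [enorm (vfield H u (g s))] is the operator, hence 0, and this norm is
   nonzero inside the ball. *)
have := enorm_frob_sgnv (gradient (fun y => H (hessian u y)) (g s))
  (vfield H u (g s)).
rewrite -(A2inftyE HC1 Oopen uC3 Os) A0// => /eqP.
by rewrite mulf_eq0 enorm_eq0 (negbTE Vs)/= => /eqP.
Qed.

Lemma frob0r (R : realType) (m n : nat) (X : 'M[R]_(m, n)) : frob X 0 = 0.
Proof. by rewrite -(scale0r (0 : 'M[R]_(m, n))) frobZ mul0r. Qed.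

Theorem proposition4 (R : realType) (n : nat) (H : 'M[R]_n -> R)
    (Omega : set 'cV[R]_n) (u : 'cV[R]_n -> R)
    (HC1 : C1_symm H) (Oopen : open Omega) (uC3 : Ck 3 Omega u) :
  [/\ forall x, Omega x -> {for x, continuous (vfield H u)},
      forall (x : 'cV[R]_n) (a b : R) (g : R -> 'cV[R]_n),
        Omega x -> vfield H u x != 0 ->
        is_trajectory Omega (vfield H u) x a b g ->
        forall t, t \in `]a, b[ ->
          derivable (fun s => H (hessian u (g s))) t 1 /\
          enorm (vfield H u (g t)) * derive1 (fun s => H (hessian u (g s))) t =
            A2infty H u (g t)
    & (forall x, Omega x -> A2infty H u x = 0) <->
      (forall x, Omega x -> vfield H u x != 0 ->
        exists (eps : R) (g : R -> 'cV[R]_n),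
          [/\ 0 < eps,
              is_trajectory Omega (vfield H u) x (- eps) eps g,
              C1_curve (- eps) eps g
            & forall t, `|t| < eps -> H (hessian u (g t)) = H (hessian u x)])].
Proof.
split => [x Ox|x a b g Ox Vx traj t tab|].
- exact: continuous_vfield HC1 Oopen uC3 Ox.
- exact: trajectory_identity traj tab.
split => [A0 x Ox Vx|ex x Ox]; first exact: exists_trajectory.
have [V0|V0] := eqVneq (vfield H u x) 0.
  by rewrite (A2inftyE HC1 Oopen uC3 Ox) V0 frob0r.
have [eps [g [eps0 traj _ Hg]]] := ex x Ox V0.
have e0 : 0 \in `](- eps), eps[ by rewrite in_itv/= oppr_lt0 eps0.
have [_] := trajectory_identity HC1 Oopen uC3 V0 Ox traj e0.
have [_ _ _ ->] := traj; move=> <-.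
(* At time 0 the curve is at [x], so the identity there expresses [A2infty H u x] through the
   derivative of a function constant near 0. *)
suff [_ H0] : is_derive (0 : R) 1 (fun s => H (hessian u (g s))) 0.
  by rewrite derive1E H0 mulr0.
have n0 : `|0 : R| < eps by rewrite normr0.
apply/is_derive1P => e e0'; apply: filterS (near_in_itvoo e0) => s.
rewrite in_itv/= -ltr_norml => /Hg ->; rewrite (Hg _ n0).
by rewrite scaler0 subrr subr0 normr0 mulr_ge0// ltW.
Qed.
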